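(* Let $q$ be a power of an odd prime and let $e$ be a primitive element of $\mathbb F_{q^2}$ (a generator of $\mathbb F_{q^2}^*$). Then $$\mathcal M_q=H\rtimes\langle\alpha\rangle,$$ where $\alpha$ is the projectivity associated to the matrix $$\begin{pmatrix} 0 & e^{-1} & 0\\ -e^{q} & 1+e^{q-1} & 0\\ 0&0&1\end{pmatrix}.$$
   Context: Let $q=p^h$ with $p$ an odd prime and let $\mathbb K$ be the algebraic closure of $\mathbb F_{q^2}$. The Hermitian curve $\mathcal H_q$ is taken in the plane model $XY^q-YX^q+\omega Z^{q+1}=0$, where $\omega\in\mathbb K$ is fixed with $\omega^{q-1}=-1$. Its automorphism group is $\mathrm{PGU}(3,q)$, the group of projectivities preserving $\mathcal H_q$. $\mathcal M_q$ is the stabilizer in $\mathrm{PGU}(3,q)$ of the point $P_0=(0:0:1)$ (equivalently of its polar line $\ell:Z=0$); it is the group of all matrices $\begin{pmatrix} a&b&0\\c&d&0\\0&0&1\end{pmatrix}$ (acting by $(X,Y,Z)\mapsto(aX+bY,cX+dY,Z)$) with $ac^q-a^qc=0$, $bd^q-b^qd=0$, $bc^q-a^qd=-1$, $ad^q-b^qc=1$. $H\cong SL(2,q)$ is the subgroup of those matrices with $a,b,c,d\in\mathbb F_q$ and $ad-bc=1$. The product is an internal semidirect product with $H$ normal. *)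

(* Defs.v *)
From HB Require Import structures.
From mathcomp Require Import all_boot all_order all_algebra.
From mathcomp Require Import mathcomp_extra boolp classical_sets.
Set Implicit Arguments.
Unset Strict Implicit.
Unset Printing Implicit Defensive.
Import GRing.Theory.
Local Open Scope quotient_scope.
Local Open Scope classical_set_scope.
Local Open Scope ring_scope.

Section Subgroups.
Variable gT : groupType.
Implicit Types G N A : set gT.

Definition is_subgroup G := group_closed [in G].

Definition cyclic_subgroup (x : gT) : set gT :=
  [set y | exists n : nat, y = (x ^+ n)%g \/ y = (x ^- n)%g].

Definition is_normal_in N G :=
  N `<=` G /\ forall g x, G g -> N x -> N (x ^ g)%g.

(* G is the internal semidirect product N ><| A, with N normal. *)
Definition is_internal_sdprod G N A :=
  [/\ [/\ is_subgroup G, is_subgroup N & is_subgroup A],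
      is_normal_in N G,
      A `<=` G,
      N `&` A = [set 1%g]
    & G = [set (x * y)%g | x in N & y in A]].

End Subgroups.

Section PGL3.
Variable K : fieldType.

Definition GL3 := {A : 'M[K]_3 | A \in unitmx}.

Definition mx_prop (A B : GL3) : bool :=
  `[< exists2 c : K, c != 0 & val B = c *: val A >].

Lemma mx_prop_refl : reflexive mx_prop.
Proof. by move=> A; apply/asboolP; exists 1; rewrite ?oner_neq0 ?scale1r. Qed.

Lemma mx_prop_sym : symmetric mx_prop.
Proof.
suff H A B : mx_prop A B -> mx_prop B A by move=> A B; apply/idP/idP; apply: H.
move=> /asboolP [c c0 E]; apply/asboolP; exists c^-1; first by rewrite invr_eq0.
by rewrite E scalerA mulVf // scale1r.
Qed.

Lemma mx_prop_trans : transitive mx_prop.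
Proof.
move=> B A C /asboolP [c c0 E] /asboolP [d d0 F]; apply/asboolP.
by exists (d * c); rewrite ?mulf_neq0 // F E scalerA.
Qed.

Canonical mx_prop_equiv :=
  EquivRel mx_prop mx_prop_refl mx_prop_sym mx_prop_trans.

Definition PGL3 := {eq_quot mx_prop_equiv}%qT.
HB.instance Definition _ := EqQuotient.on PGL3.
HB.instance Definition _ := Choice.on PGL3.

Lemma PGL3_eqP (A B : GL3) :
  (exists2 c : K, c != 0 & val B = c *: val A) <-> \pi_PGL3 A = \pi_PGL3 B.
Proof. by split=> [H | /eqmodP /asboolP //]; apply/eqmodP/asboolP. Qed.

Definition GL3_one : GL3 := exist _ 1%:M (unitmx1 K 3).
Definition GL3_inv (A : GL3) : GL3 :=
  exist _ (invmx (val A)) (etrans (unitmx_inv (val A)) (valP A)).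
Fact GL3_mul_subproof (A B : GL3) : val A *m val B \in unitmx.
Proof. by rewrite unitmx_mul (valP A) (valP B). Qed.
Definition GL3_mul (A B : GL3) : GL3 := exist _ (val A *m val B) (GL3_mul_subproof A B).

Definition PGL3_one : PGL3 := \pi_PGL3 GL3_one.
Definition PGL3_inv (g : PGL3) : PGL3 := \pi_PGL3 (GL3_inv (repr g)).
Definition PGL3_mul (g h : PGL3) : PGL3 := \pi_PGL3 (GL3_mul (repr g) (repr h)).

Lemma repr_PGL3 (A : GL3) :
  exists2 c : K, c != 0 & val (repr (\pi_PGL3 A)) = c *: val A.
Proof. by apply/PGL3_eqP; rewrite reprK. Qed.

Lemma PGL3_invE (A : GL3) : PGL3_inv (\pi_PGL3 A) = \pi_PGL3 (GL3_inv A).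
Proof.
have [c c0 E] := repr_PGL3 A; apply/PGL3_eqP; exists c => //=.
by rewrite E invmxZ ?unitmxZ ?unitfE ?(valP A) // scalerA divff // scale1r.
Qed.

Lemma PGL3_mulE (A B : GL3) :
  PGL3_mul (\pi_PGL3 A) (\pi_PGL3 B) = \pi_PGL3 (GL3_mul A B).
Proof.
have [c c0 E] := repr_PGL3 A; have [d d0 F] := repr_PGL3 B.
apply/PGL3_eqP; exists (c * d)^-1; rewrite ?invr_eq0 ?mulf_neq0 //=.
rewrite E F -scalemxAl -scalemxAr !scalerA -mulrA mulVf ?scale1r //.
exact: mulf_neq0.
Qed.

Lemma PGL3_ind (P : PGL3 -> Prop) : (forall A, P (\pi_PGL3 A)) -> forall g, P g.
Proof. by move=> H g; rewrite -[g]reprK. Qed.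

Fact PGL3_mulA : associative PGL3_mul.
Proof.
elim/PGL3_ind=> A; elim/PGL3_ind=> B; elim/PGL3_ind=> C.
by rewrite !PGL3_mulE; congr (\pi_PGL3 _); apply: val_inj; rewrite /= mulmxA.
Qed.

Fact PGL3_mul1 : left_id PGL3_one PGL3_mul.
Proof.
elim/PGL3_ind=> A; rewrite PGL3_mulE.
by congr (\pi_PGL3 _); apply: val_inj; rewrite /= mul1mx.
Qed.

Fact PGL3_1mul : right_id PGL3_one PGL3_mul.
Proof.
elim/PGL3_ind=> A; rewrite PGL3_mulE.
by congr (\pi_PGL3 _); apply: val_inj; rewrite /= mulmx1.
Qed.

Fact PGL3_mulV : left_inverse PGL3_one PGL3_inv PGL3_mul.
Proof.
elim/PGL3_ind=> A; rewrite PGL3_invE PGL3_mulE.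
by congr (\pi_PGL3 _); apply: val_inj; rewrite /= mulVmx // (valP A).
Qed.

Fact PGL3_Vmul : right_inverse PGL3_one PGL3_inv PGL3_mul.
Proof.
elim/PGL3_ind=> A; rewrite PGL3_invE PGL3_mulE.
by congr (\pi_PGL3 _); apply: val_inj; rewrite /= mulmxV // (valP A).
Qed.

HB.instance Definition _ := isGroup.Build PGL3
  PGL3_mulA PGL3_mul1 PGL3_1mul PGL3_mulV PGL3_Vmul.

(* Singular matrices are sent to 1; they never occur below (linmx_unit,       *)
(* alpha_mx_unit).                                                            *)
Definition projectivity (A : 'M[K]_3) : PGL3 := \pi_PGL3 (insubd GL3_one A).

Definition nzvec := {v : 'cV[K]_3 | v != 0}.

Definition vec_prop (u v : nzvec) : bool :=
  `[< exists2 c : K, c != 0 & val v = c *: val u >].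

Lemma vec_prop_refl : reflexive vec_prop.
Proof. by move=> A; apply/asboolP; exists 1; rewrite ?oner_neq0 ?scale1r. Qed.

Lemma vec_prop_sym : symmetric vec_prop.
Proof.
suff H u v : vec_prop u v -> vec_prop v u by move=> u v; apply/idP/idP; apply: H.
move=> /asboolP [c c0 E]; apply/asboolP; exists c^-1; first by rewrite invr_eq0.
by rewrite E scalerA mulVf // scale1r.
Qed.

Lemma vec_prop_trans : transitive vec_prop.
Proof.
move=> v u w /asboolP [c c0 E] /asboolP [d d0 F]; apply/asboolP.
by exists (d * c); rewrite ?mulf_neq0 // F E scalerA.
Qed.

Canonical vec_prop_equiv :=
  EquivRel vec_prop vec_prop_refl vec_prop_sym vec_prop_trans.

Definition PG2 := {eq_quot vec_prop_equiv}%qT.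
HB.instance Definition _ := EqQuotient.on PG2.
HB.instance Definition _ := Choice.on PG2.

Lemma PG2_eqP (u v : nzvec) :
  (exists2 c : K, c != 0 & val v = c *: val u) <-> \pi_PG2 u = \pi_PG2 v.
Proof. by split=> [H | /eqmodP /asboolP //]; apply/eqmodP/asboolP. Qed.

Lemma repr_PG2 (v : nzvec) :
  exists2 c : K, c != 0 & val (repr (\pi_PG2 v)) = c *: val v.
Proof. by apply/PG2_eqP; rewrite reprK. Qed.

Fact mulGL3v_subproof (A : GL3) (v : nzvec) : val A *m val v != 0.
Proof.
apply: contraNneq (valP v) => E; apply/eqP.
by rewrite -(mulKmx (valP A) (val v)) E mulmx0.
Qed.
Definition mulGL3v (A : GL3) (v : nzvec) : nzvec := exist _ (val A *m val v) (mulGL3v_subproof A v).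

Definition pact (g : PGL3) (P : PG2) : PG2 := \pi_PG2 (mulGL3v (repr g) (repr P)).

Lemma pactE (A : GL3) (v : nzvec) :
  pact (\pi_PGL3 A) (\pi_PG2 v) = \pi_PG2 (mulGL3v A v).
Proof.
have [c c0 E] := repr_PGL3 A; have [d d0 F] := repr_PG2 v.
apply/PG2_eqP; exists (c * d)^-1; rewrite ?invr_eq0 ?mulf_neq0 //=.
rewrite E F -scalemxAl -scalemxAr !scalerA -mulrA mulVf ?scale1r //.
exact: mulf_neq0.
Qed.

(* P_0 = (0 : 0 : 1) *)
Fact P0_subproof : delta_mx (2%:R : 'I_3) 0 != 0 :> 'cV[K]_3.
Proof. by apply/eqP=> /matrixP/(_ 2%:R 0)/eqP; rewrite !mxE !eqxx oner_eq0. Qed.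
Definition P0 : PG2 := \pi_PG2 (exist _ (delta_mx 2%:R 0) P0_subproof).

Definition hermitian_form (q : nat) (omega : K) (v : 'cV[K]_3) : K :=
  let X := v 0 0 in let Y := v 1 0 in let Z := v 2%:R 0 in
  X * Y ^+ q - Y * X ^+ q + omega * Z ^+ q.+1.

Definition hermitian_curve q omega : set PG2 :=
  [set P | hermitian_form q omega (val (repr P)) = 0].

Lemma hermitian_curveE q omega (v : nzvec) :
  hermitian_curve q omega (\pi_PG2 v) <-> hermitian_form q omega (val v) = 0.
Proof.
have [c c0 E] := repr_PG2 v; rewrite /hermitian_curve /=.
have -> : hermitian_form q omega (val (repr (\pi_PG2 v)))
        = c ^+ q.+1 * hermitian_form q omega (val v).
  rewrite E /hermitian_form !mxE !exprMn !exprS.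
  rewrite mulrDr mulrBr !mulrA; congr (_ - _ + _).
  - by rewrite -!mulrA; congr (_ * _); rewrite mulrCA.
  - by rewrite -!mulrA; congr (_ * _); rewrite mulrCA.
  - by rewrite -!mulrA mulrCA; congr (_ * _); rewrite mulrCA; congr (_ * _); rewrite mulrCA.
split=> [/eqP|->]; last by rewrite mulr0.
by rewrite mulf_eq0 expf_eq0 (negPf c0) => /eqP.
Qed.

Definition PGU3 q omega : set PGL3 :=
  [set g | pact g @` hermitian_curve q omega = hermitian_curve q omega].

Definition Mq q omega : set PGL3 := [set g | PGU3 q omega g /\ pact g P0 = P0].

Definition linmx (a b c d : K) : 'M[K]_3 := \matrix_(i < 3, j < 3)
  nth 0 (nth [::] [:: [:: a; b; 0];
                      [:: c; d; 0];
                      [:: 0; 0; 1]] i) j.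

Lemma linmx_unit a b c d : (linmx a b c d \in unitmx) = (a * d - b * c != 0).
Proof.
rewrite unitmxE unitfE; congr (_ != 0).
rewrite !(expand_det_row _ 0) /cofactor !big_ord_recl !big_ord0.
rewrite !(expand_det_row _ 0) /cofactor !big_ord_recl !big_ord0 !det_mx11.
rewrite !mxE /=.
by rewrite /= expr0 expr1 !(mul0r, mulr0, addr0, mul1r, mulr1, mulN1r) mulrN.
Qed.

Definition alpha_mx (q : nat) (e : K) : 'M[K]_3 :=
  linmx 0 e^-1 (- e ^+ q) (1 + e ^+ (q - 1)).

Lemma alpha_mx_unit q e : e != 0 -> alpha_mx q e \in unitmx.
Proof.
move=> e0; rewrite linmx_unit mul0r sub0r mulrN opprK.
by rewrite mulf_neq0 ?invr_eq0 ?expf_neq0.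
Qed.

End PGL3.

(* iota is the embedding of F_q in K. *)
Definition SL2q (Fq : finFieldType) (K : fieldType) (iota : {rmorphism Fq -> K}) :
    set (PGL3 K) :=
  [set g | exists a b c d : Fq, a * d - b * c = 1 /\
     g = projectivity (linmx (iota a) (iota b) (iota c) (iota d))].

(* Main.v *)
From mathcomp Require Import boolp classical_sets.
Require Import Defs.
From mathcomp Require Import all_boot all_order all_algebra all_fingroup.
From mathcomp Require Import all_solvable all_field.
From mathcomp Require Import ring.
Import GRing.Theory.
Local Open Scope ring_scope.

(** Everything is controlled by the determinant of the upper-left 2 x 2 block of
    a projectivity fixing P_0, the matrix being normalised so that its last
    diagonal entry is 1.

    The stabiliser M_q of P_0 consists of the projectivities of block matrices
    M = (a b; c d) satisfying D M^(q) = M, where D = det M and M^(q) is the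
    entrywise q-th power ([MqP]).  That such matrices preserve the Hermitian
    form X Y^q - Y X^q + omega Z^(q+1) is a computation.  Conversely, let a
    matrix with last column (0, 0, 1) and last row (u, v, 1) preserve the curve.
    Over a fixed (X, Y) the points of the curve are Z zeta^n, with zeta a
    primitive (q+1)-th root of unity.  The equation of the image point, viewed
    as a function of n, forces u X + v Y = 0 when the fibre has nonzero Z
    ([zeta_fiber_eq0]).  Two such fibres give u = v = 0, and comparing the
    remaining coefficients gives the relations on a, b, c, d
    ([curve_preserving_unitary]).

    Taking determinants in D M^(q) = M gives D^(q+1) = 1, so the determinant is
    a character of M_q with values in the (q+1)-th roots of unity
    ([block_detM], [block_det_norm]).  If D = 1 the relation says that all
    entries are fixed by the q-th power map, that is, lie in F_q: the kernel of
    the character is SL(2, q) ([SL2q_Mq]).  The matrix alpha lies in M_q and has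
    determinant zeta = e^(q-1), a primitive (q+1)-th root of unity.  It is
    diagonalisable with eigenvalues 1 and zeta on the block, so its order is
    exactly q+1 ([alpha_expg]).  Hence the powers of alpha split the character,
    which is the claimed semidirect product ([is_internal_sdprod_character]). *)

(** * Splitting a character *)

(** If [x] has order dividing [m] and [chi x] generates the values of [chi], the
    powers of [x] are a section of [chi], so they form a complement of its
    kernel. *)
Lemma is_internal_sdprod_character (gT : groupType) (F : fieldType)
    (G N : set gT) (chi : gT -> F) (m : nat) (x : gT) :
  is_subgroup G ->
  (forall g h, G g -> G h -> chi (g * h)%g = chi g * chi h) ->
  (forall g, G g -> chi g ^+ m = 1) ->
  (forall g, N g <-> G g /\ chi g = 1) ->
  G x -> (x ^+ m = 1)%g -> m.-primitive_root (chi x) ->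
  is_internal_sdprod G N (cyclic_subgroup x).
Proof.
move=> sG chiM chim NE Gx xm prx.
have m_gt0 := prim_order_gt0 prx.
have [G1 GD] : G 1%g /\ forall g h, G g -> G h -> G (g * h^-1)%g.
  case: sG => /set_mem G1 GD; split=> // g h Gg Gh.
  by apply/set_mem/GD; apply: mem_set.
have GV g : G g -> G (g^-1)%g by move=> Gg; rewrite -[(g^-1)%g]mul1g; apply: GD.
have GM g h : G g -> G h -> G (g * h)%g.
  by move=> Gg Gh; rewrite -[h]invgK; apply/GD/GV.
have GX n : G (x ^+ n)%g.
  by elim: n => [|n IH]; rewrite ?expg0 // expgS; apply: GM.
have chi1 : chi 1%g = 1.
  have /eqP := chiM _ _ G1 G1; rewrite mulg1 -subr_eq0 -{1}[chi 1%g]mulr1 -mulrBr.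
  rewrite mulf_eq0 subr_eq0 => /orP[/eqP c0|/eqP //].
  by have /eqP := chim _ G1; rewrite c0 expr0n gtn_eqF // eq_sym oner_eq0.
have chiX n : chi (x ^+ n)%g = chi x ^+ n.
  by elim: n => [|n IH]; rewrite ?expg0 ?expr0 // expgS exprS chiM // IH.
have chiV g : G g -> chi g * chi (g^-1)%g = 1.
  by move=> Gg; rewrite -chiM ?mulgV //; apply: GV.
(* As x^m = 1, the negative power x^-n is the positive power x^(n (m-1)). *)
have xE y : cyclic_subgroup x y <-> exists n, y = (x ^+ n)%g.
  split=> [[n [->|->]]|[n ->]]; [by exists n | | by exists n; left].
  exists (n * m.-1)%N; apply: (mulgI (x ^+ n)%g); rewrite mulgV -expgnDr.
  by rewrite -mulnS prednK // mulnC expgnA xm expg1n.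
have subgroupI (H : set gT) : H 1%g ->
    (forall g h, H g -> H h -> H (g * h^-1)%g) -> is_subgroup H.
  move=> H1 HD; split; first exact: mem_set.
  by move=> g h /set_mem Hg /set_mem Hh; apply/mem_set/HD.
split.
- split=> //; apply: subgroupI; first exact/NE.
  + move=> g h /NE[Gg cg] /NE[Gh ch]; apply/NE; split; first exact: GD.
    by rewrite chiM ?cg ?mul1r -?(chiV h) ?ch ?mul1r //; apply: GV.
  + by apply/xE; exists 0%N; rewrite expg0.
  + move=> _ _ /xE[i ->] /xE[j ->].
    have /xE[k ->] : cyclic_subgroup x (x ^- j)%g by exists j; right.
    by apply/xE; exists (i + k)%N; rewrite expgnDr.
- split=> [g /NE[]//|g y Gg /NE[Gy cy]]; apply/NE.
  have Gyg : G (y * g)%g by apply: GM.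
  rewrite /conjg; split; first by apply: GM => //; apply: GV.
  by rewrite !chiM ?cy ?mul1r 1?mulrC ?chiV //; apply: GV.
- by move=> _ /xE[n ->].
- apply/seteqP; split=> [y [/NE[_ cy] /xE[n def_y]]|_ ->] /=.
    move: cy; rewrite def_y chiX => /eqP.
    rewrite -(prim_order_dvd prx) => /dvdnP[k ->].
    by rewrite mulnC expgnA xm expg1n.
  by split; [apply/NE | apply/xE; exists 0%N; rewrite expg0].
- apply/seteqP; split=> [g Gg|_ [y /NE[Gy _]] [_ /xE[n ->] <-]]; last exact: GM.
  have [i Ei] := prim_rootP prx (chim _ Gg).
  have Gi := GX i; have GiV := GV _ Gi.
  exists (g * x ^- i)%g; last first.
    by exists (x ^+ i)%g; [apply/xE; exists i | rewrite mulgVK].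
  by apply/NE; split; [exact: GM | rewrite chiM // Ei -chiX chiV].
Qed.

(** * Projectivities of block matrices *)

Section Projectivities.
Variable K : fieldType.
Implicit Types (a b c d : K) (A B : 'M[K]_3) (g h : PGL3 K).

Lemma ord3E (i : 'I_3) : [\/ i = 0, i = 1 | i = 2%:R].
Proof.
by case: i => [[|[|[|]]]] // ?;
  [apply: Or31 | apply: Or32 | apply: Or33]; apply: val_inj.
Qed.

Lemma sum_ord3 (f : 'I_3 -> K) : \sum_i f i = f 0 + f 1 + f 2%:R.
Proof.
rewrite !big_ord_recl big_ord0 addr0 addrA.
by congr (_ + f _ + f _); apply: val_inj.
Qed.

Lemma det_fix_P0 A : (forall i, A i 2%:R = (i == 2%:R)%:R) ->
  \det A = A 0 0 * A 1 1 - A 0 1 * A 1 0.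
Proof.
move=> A2; rewrite (expand_det_col _ 2%:R) sum_ord3 !A2 /= !(mul0r, add0r) mul1r.
rewrite /cofactor -signr_odd addnn odd_double expr0 mul1r.
rewrite (expand_det_row _ 0) !big_ord_recl big_ord0 /cofactor !det_mx11 addr0.
rewrite !mxE /= /bump /= addn0 addn1 expr0 expr1 mul1r mulN1r mulrN.
by congr (A _ _ * A _ _ - A _ _ * A _ _); apply: val_inj.
Qed.

Lemma linmxM a b c d a' b' c' d' :
  linmx a b c d *m linmx a' b' c' d' =
  linmx (a * a' + b * c') (a * b' + b * d') (c * a' + d * c') (c * b' + d * d').
Proof.
apply/matrixP=> i j; rewrite !mxE sum_ord3.
by case: (ord3E i) => ->; case: (ord3E j) => ->; rewrite !mxE /=;
  rewrite !(mulr0, mul0r, addr0, add0r, mulr1).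
Qed.

Lemma projectivityE A (uA : A \in unitmx) :
  projectivity A = (\pi_(PGL3 K) (exist _ A uA))%qT.
Proof.
by congr (\pi_(PGL3 K) _)%qT; apply: val_inj; rewrite /= val_insubd uA.
Qed.

Lemma projectivityM A B : A \in unitmx -> B \in unitmx ->
  projectivity (A *m B) = (projectivity A * projectivity B)%g.
Proof.
move=> uA uB; have uAB : A *m B \in unitmx by rewrite unitmx_mul uA.
rewrite !projectivityE [RHS]PGL3_mulE; congr (\pi_(PGL3 K) _)%qT.
exact: val_inj.
Qed.

Lemma linmx1 : linmx 1 0 0 1 = 1%:M :> 'M[K]_3.
Proof.
apply/matrixP=> i j; rewrite !mxE.
by case: (ord3E i) => ->; case: (ord3E j) => ->.
Qed.

Lemma projectivity1 : projectivity 1%:M = 1%g :> PGL3 K.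
Proof. by rewrite (projectivityE _ (unitmx1 K 3)). Qed.

(** Dividing by the square of the last diagonal entry makes the 2 x 2 minor
    independent of the representative; when [g] is the class of a matrix
    [linmx a b c d], the value is the determinant of the block. *)
Definition block_det g : K :=
  let A := val (generic_quotient.repr g) in
  (A 0 0 * A 1 1 - A 0 1 * A 1 0) / A 2%:R 2%:R ^+ 2.

Lemma block_det_linmx a b c d : a * d - b * c != 0 ->
  block_det (projectivity (linmx a b c d)) = a * d - b * c.
Proof.
rewrite -linmx_unit => uA; rewrite projectivityE /block_det.
have [k k0 ->] := repr_PGL3 (exist (fun A => A \in unitmx) _ uA).
rewrite !mxE /=.
by field; exact: k0.
Qed.

Lemma pactM g h P : pact (g * h)%g P = pact g (pact h P).
Proof.
rewrite -[g]generic_quotient.reprK -[h]generic_quotient.reprK.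
rewrite -[P]generic_quotient.reprK.
move: (generic_quotient.repr g) (generic_quotient.repr h) => A B.
move: (generic_quotient.repr P) => v.
rewrite [(_ * _)%g]PGL3_mulE (pactE B) !pactE; congr (\pi_(PG2 K) _)%qT.
by apply: val_inj; rewrite /= mulmxA.
Qed.

Lemma pact1 P : pact 1%g P = P :> PG2 K.
Proof.
rewrite -[P]generic_quotient.reprK; move: (generic_quotient.repr P) => v.
rewrite pactE; congr (\pi_(PG2 K) _)%qT.
by apply: val_inj; rewrite /= mul1mx.
Qed.

Lemma Mq_subgroup q omega : is_subgroup (Mq q omega : set (PGL3 K)).
Proof.
split=> [|g h /set_mem[Hg Pg] /set_mem[Hh Ph]]; apply: mem_set.
  split; last exact: pact1.
  by rewrite /PGU3 /= (_ : pact 1%g = id) ?image_id //; apply/funext/pact1.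
have Vh P : pact (h^-1)%g (pact h P) = P by rewrite -pactM mulVg pact1.
split; last by rewrite pactM -{1}Ph Vh.
rewrite /PGU3 /= (_ : pact (g * h^-1)%g = pact g \o pact (h^-1)%g); last first.
  by apply/funext=> P; rewrite pactM.
rewrite -image_comp -{1}Hh (image_comp (pact h)).
by rewrite (_ : pact (h^-1)%g \o pact h = id) ?image_id //; apply/funext.
Qed.

End Projectivities.

Arguments block_det {K} g.

(** * The stabiliser of P_0 as a group of unitary blocks *)

Section HermitianUnitary.
Variables (K : closedFieldType) (q : nat) (omega zeta : K).
Hypothesis pcharKq : [pchar K].-nat q.
Hypothesis q_gt1 : (1 < q)%N.
Hypothesis omega_neq0 : omega != 0.
Hypothesis zeta_prim : q.+1.-primitive_root zeta.
Implicit Types (a b c d u v X Y Z : K) (A : 'M[K]_3).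

Let frobD x y : (x + y : K) ^+ q = x ^+ q + y ^+ q.
Proof. by apply: exprDn_pchar. Qed.

Let frobN x : (- x : K) ^+ q = - x ^+ q.
Proof. by apply: exprNn_pchar. Qed.

Let frobM x y : (x * y : K) ^+ q = x ^+ q * y ^+ q.
Proof. by apply: exprMn. Qed.

Let frob0 : 0 ^+ q = 0 :> K.
Proof. by rewrite expr0n gtn_eqF // ltnW. Qed.

Let zeta_neq0 : zeta != 0.
Proof.
apply/eqP=> z0; have /eqP := prim_expr_order zeta_prim.
by rewrite z0 expr0n eq_sym oner_eq0.
Qed.

Let zeta_frob : zeta ^+ q = zeta^-1.
Proof. by apply: (mulfI zeta_neq0); rewrite -exprS prim_expr_order // divff. Qed.

Let zeta_neq1 : zeta != 1.
Proof.
have := prim_order_dvd zeta_prim 1; rewrite dvdn1 expr1 => <-.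
by rewrite gtn_eqF // ltnW.
Qed.

Let zeta_neqV : zeta - zeta^-1 != 0.
Proof.
apply/eqP=> /(congr1 ( *%R zeta)); rewrite mulrBr divff // mulr0 -expr2.
move/eqP; rewrite subr_eq0 -(prim_order_dvd zeta_prim) => dv.
by have := dvdn_leq (isT : 0 < 2)%N dv; rewrite ltnNge q_gt1.
Qed.

(** The relation D M^(q) = M for the block M = (a b; c d) of determinant D; it
    says that M preserves the skew form X Y^q - Y X^q. *)
Definition unitary_block a b c d :=
  let D := a * d - b * c in
  [/\ D != 0, D * a ^+ q = a, D * b ^+ q = b, D * c ^+ q = c & D * d ^+ q = d].

Lemma curve_point X Y :
  exists Z, X * Y ^+ q - Y * X ^+ q + omega * Z ^+ q.+1 = 0.
Proof.
pose s := (Y * X ^+ q - X * Y ^+ q) / omega.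
have [Z EZ] := solve_monicpoly (fun i => if i is 0%N then s else 0) (ltn0Sn q).
exists Z; rewrite EZ big_ord_recl big1 => [|i _]; last by rewrite mul0r.
by rewrite expr0 mulr1 addr0 /s; field.
Qed.

(** The three cases n = 0, 1, q have zeta^n = 1, zeta, zeta^-1.  Subtracting the
    last two gives s = t because zeta <> zeta^-1, and comparing with the first
    gives s (zeta - 1)^2 = 0. *)
Lemma zeta_fiber_eq0 s t k :
  (forall n, s * zeta ^+ n + t * (zeta ^+ n) ^+ q = k) -> s = 0.
Proof.
move=> E; have := E 0%N; have := E 1%N; have := E q.
rewrite !zeta_frob expr0 expr1 expr1n exprVn zeta_frob invrK => Eq E1 E0.
have /eqP : (s - t) * (zeta - zeta^-1) = 0.
  by rewrite (_ : _ * _ = (s * zeta + t * zeta^-1) - (s * zeta^-1 + t * zeta));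
    [rewrite E1 Eq subrr | ring].
rewrite mulf_eq0 (negPf zeta_neqV) orbF subr_eq0 => /eqP def_t.
have /eqP : s * (zeta - 1) ^+ 2 = 0.
  rewrite (_ : _ * _ = zeta * ((s * zeta + s * zeta^-1) - (s * 1 + s * 1))).
    by rewrite {2 4}def_t E1 E0 subrr mulr0.
  by field.
by rewrite mulf_eq0 expf_eq0 /= subr_eq0 (negPf zeta_neq1) orbF => /eqP.
Qed.

(** Elements t outside F_q are what is needed twice: the curve has points
    (1, t, Z) with Z nonzero, and X^q Y and X Y^q differ at (1, t). *)
Lemma zeta_frobX_neq t : t = zeta \/ t = zeta^-1 -> t ^+ q - t != 0.
Proof.
case=> ->; first by rewrite zeta_frob -oppr_eq0 opprB.
by rewrite exprVn zeta_frob invrK.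
Qed.

(** The hypotheses are the coefficientwise form of invariance of X Y^q - Y X^q;
    each conclusion is obtained by eliminating between two of them. *)
Lemma unitary_blockE a b c d :
  a * d - b * c != 0 ->
  a * c ^+ q - c * a ^+ q = 0 -> b * d ^+ q - d * b ^+ q = 0 ->
  a * d ^+ q - c * b ^+ q = 1 -> d * a ^+ q - b * c ^+ q = 1 ->
  unitary_block a b c d.
Proof.
move=> D0 E1 E2 E3 E4; split=> //.
- rewrite (_ : _ * _ = a * (d * a ^+ q - b * c ^+ q)
       + b * (a * c ^+ q - c * a ^+ q)); last by ring.
  by rewrite E1 E4 mulr0 addr0 mulr1.
- rewrite (_ : _ * _ = b * (a * d ^+ q - c * b ^+ q)
       - a * (b * d ^+ q - d * b ^+ q)); last by ring.
  by rewrite E2 E3 mulr0 subr0 mulr1.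
- rewrite (_ : _ * _ = c * (d * a ^+ q - b * c ^+ q)
       + d * (a * c ^+ q - c * a ^+ q)); last by ring.
  by rewrite E1 E4 mulr0 addr0 mulr1.
- rewrite (_ : _ * _ = d * (a * d ^+ q - c * b ^+ q)
       - c * (b * d ^+ q - d * b ^+ q)); last by ring.
  by rewrite E2 E3 mulr0 subr0 mulr1.
Qed.

(** Only the points of the curve are available as test data, so polynomial
    identities are extracted from well-chosen points. *)
Lemma curve_preserving_unitary a b c d u v :
  a * d - b * c != 0 ->
  (forall X Y Z, (X != 0) || (Y != 0) ->
    X * Y ^+ q - Y * X ^+ q + omega * Z ^+ q.+1 = 0 ->
    (a * X + b * Y) * (c * X + d * Y) ^+ q
      - (c * X + d * Y) * (a * X + b * Y) ^+ q
      + omega * (u * X + v * Y + Z) ^+ q.+1 = 0) ->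
  [/\ u = 0, v = 0 & unitary_block a b c d].
Proof.
move=> D0 pres.
have line0 t : t = zeta \/ t = zeta^-1 -> u + v * t = 0.
  move=> /zeta_frobX_neq tq; have [Z EZ] := curve_point 1 t.
  have Z0 : Z != 0.
    apply: contraNneq tq => Z0; move: EZ.
    by rewrite Z0 expr0n mulr0 addr0 mul1r expr1n mulr1 => ->.
  (* The points (1, t, Z zeta^n) all lie on the curve.  Expanding the equation
     of their images, only the two mixed terms depend on n. *)
  have /zeta_fiber_eq0/eqP : forall n, (u + v * t) ^+ q * Z * zeta ^+ n
      + (u + v * t) * Z ^+ q * (zeta ^+ n) ^+ q =
    - (((a + b * t) * (c + d * t) ^+ q - (c + d * t) * (a + b * t) ^+ q)
       / omega + (u + v * t) ^+ q.+1 + Z ^+ q.+1).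
    move=> n; have zn : (zeta ^+ n) ^+ q.+1 = 1.
      by rewrite exprAC (prim_expr_order zeta_prim) expr1n.
    have := pres 1 t (Z * zeta ^+ n).
    rewrite oner_eq0 exprMn zn !mulr1 => /(_ isT EZ) /eqP.
    rewrite addrC addr_eq0 => /eqP E; apply/eqP; rewrite -addr_eq0; apply/eqP.
    apply: (mulfI omega_neq0); rewrite mulr0.
    rewrite [LHS](_ : _ = omega * (u + v * t + Z * zeta ^+ n) ^+ q.+1
      + ((a + b * t) * (c + d * t) ^+ q - (c + d * t) * (a + b * t) ^+ q)).
      by rewrite E addNr.
    have -> : (u + v * t + Z * zeta ^+ n) ^+ q.+1 = (u + v * t + Z * zeta ^+ n)
        * ((u + v * t) ^+ q + Z ^+ q * (zeta ^+ n) ^+ q).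
      by rewrite exprS frobD frobM.
    have -> : Z ^+ q.+1 = Z * Z ^+ q * (zeta ^+ n * (zeta ^+ n) ^+ q).
      by rewrite -[zeta ^+ n * _]exprS zn mulr1 exprS.
    rewrite [(u + v * t) ^+ q.+1]exprS.
    by field; exact: omega_neq0.
  by rewrite mulf_eq0 expf_eq0 (negPf Z0) orbF => /andP[_ /eqP].
have Ez := line0 _ (or_introl erefl); have EV := line0 _ (or_intror erefl).
have v0 : v = 0.
  have /eqP : v * (zeta - zeta^-1) = 0.
    rewrite (_ : _ * _ = (u + v * zeta) - (u + v * zeta^-1)); last by ring.
    by rewrite Ez EV subrr.
  by rewrite mulf_eq0 (negPf zeta_neqV) orbF => /eqP.
have u0 : u = 0 by move: Ez; rewrite v0 mul0r addr0.
(* Above every (X, Y) there is a point of the curve, whose Z is now fixed. *)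
have form X Y : (X != 0) || (Y != 0) ->
    (a * X + b * Y) * (c * X + d * Y) ^+ q
      - (c * X + d * Y) * (a * X + b * Y) ^+ q = X * Y ^+ q - Y * X ^+ q.
  move=> nz; have [Z EZ] := curve_point X Y; have := pres X Y Z nz EZ.
  by rewrite u0 v0 !mul0r !add0r -EZ => /addIr.
split=> //.
have E1 : a * c ^+ q - c * a ^+ q = 0.
  have := form 1 0; rewrite oner_eq0 => /(_ isT).
  by rewrite !mulr1 !mulr0 !addr0 frob0 mul0r mulr0 subrr.
have E2 : b * d ^+ q - d * b ^+ q = 0.
  have := form 0 1; rewrite oner_eq0 orbT => /(_ isT).
  by rewrite !mulr1 !mulr0 !add0r frob0 mul0r mulr0 subrr.
(* The coefficients of X^q Y and X Y^q cancel against each other at every t;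
   t = 1 and t = zeta then show that both vanish. *)
pose m := d * a ^+ q - b * c ^+ q - 1.
pose n := a * d ^+ q - c * b ^+ q - 1.
have mn t : m * t = n * t ^+ q.
  have := form 1 t; rewrite oner_eq0 => /(_ isT) /eqP; rewrite -subr_eq0 => /eqP.
  rewrite !(frobD, frobM, expr1n) mulr1 mul1r => E.
  apply/eqP; rewrite eq_sym -subr_eq0 -E; apply/eqP.
  rewrite [RHS](_ : _ = n * t ^+ q - m * t + (a * c ^+ q - c * a ^+ q)
    + t * t ^+ q * (b * d ^+ q - d * b ^+ q)).
    by rewrite E1 E2 mulr0 !addr0.
  by rewrite /m /n; ring.
have n_eq0 : n = 0.
  have mn1 : m = n by have := mn 1; rewrite expr1n !mulr1.
  have /eqP : n * (zeta ^+ q - zeta) = 0 by rewrite mulrBr -mn mn1 subrr.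
  by rewrite mulf_eq0 (negPf (zeta_frobX_neq _ (or_introl erefl))) orbF => /eqP.
have m_eq0 : m = 0 by have := mn 1; rewrite n_eq0 mulr1 mul0r.
by apply: unitary_blockE => //; apply/eqP; rewrite -subr_eq0; apply/eqP.
Qed.

(** After multiplication by D, each q-th power of an entry becomes the entry
    itself and the skew form picks up the factor det M = D. *)
Lemma hermitian_form_unitary a b c d (w : 'cV[K]_3) : unitary_block a b c d ->
  hermitian_form q omega (linmx a b c d *m w) = hermitian_form q omega w.
Proof.
rewrite /hermitian_form => -[D0 Ea Eb Ec Ed].
rewrite !mxE !sum_ord3 !mxE /= !(mul0r, addr0, add0r, mul1r).
move: (w 0 0) (w 1 0) => X Y; congr (_ + _); rewrite !(frobD, frobM).
apply: (mulfI D0).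
transitivity ((a * X + b * Y) * ((a * d - b * c) * c ^+ q * X ^+ q
    + (a * d - b * c) * d ^+ q * Y ^+ q)
  - (c * X + d * Y) * ((a * d - b * c) * a ^+ q * X ^+ q
    + (a * d - b * c) * b ^+ q * Y ^+ q)); first by ring.
by rewrite Ea Eb Ec Ed; ring.
Qed.

Lemma Mq_unitary a b c d :
  unitary_block a b c d -> Mq q omega (projectivity (linmx a b c d)).
Proof.
move=> uni; have uA : linmx a b c d \in unitmx by rewrite linmx_unit; case: uni.
rewrite projectivityE.
set A : GL3 K := exist (fun A => is_true (A \in unitmx)) _ uA.
have formA w : hermitian_form q omega (val A *m w) = hermitian_form q omega w.
  exact: hermitian_form_unitary.
split; last first.
  rewrite pactE; apply/PG2_eqP; exists 1; rewrite ?oner_neq0 // scale1r.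
  apply/matrixP=> i j; rewrite ord1 !mxE sum_ord3 !mxE /=.
  by case: (ord3E i) => ->; rewrite /= !(mulr0, mul0r, addr0, add0r, mulr1).
apply/seteqP; split=> [_ [P CP <-]|P CP].
  move: CP; rewrite -[P]generic_quotient.reprK pactE.
  by rewrite !hermitian_curveE /= formA.
exists (pact ((\pi_(PGL3 K) A)%qT^-1)%g P); last by rewrite -pactM mulgV pact1.
move: CP; rewrite -[P]generic_quotient.reprK [(_^-1)%g]PGL3_invE pactE.
by rewrite !hermitian_curveE /= -[in X in _ -> X]formA mulKVmx.
Qed.

(** Fixing P_0 constrains the last column only; that the last row is also
    (0, 0, 1), so that the polar line Z = 0 is fixed, comes from the curve. *)
Lemma MqP g : Mq q omega g <->
  exists a b c d, unitary_block a b c d /\ g = projectivity (linmx a b c d).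
Proof.
split=> [[]|[a [b [c [d [uni ->]]]]]]; last exact: Mq_unitary.
rewrite -[g]generic_quotient.reprK; move: (generic_quotient.repr g) => A.
move=> PGU; rewrite pactE => /PG2_eqP[k k0 /= /matrixP EA].
pose B := k *: val A.
have uB : B \in unitmx by rewrite unitmxZ ?unitfE ?(valP A).
(* The scalar k normalises the last column, the image of P_0, to (0, 0, 1). *)
have B2 i : B i 2%:R = (i == 2%:R)%:R.
  have := EA i 0; rewrite !mxE sum_ord3 !mxE /= !(mulr0, add0r, mulr1).
  by rewrite andbT => <-.
pose B' : GL3 K := exist (fun A => is_true (A \in unitmx)) _ uB.
have AB : (\pi_(PGL3 K) A)%qT = (\pi_(PGL3 K) B')%qT.
  by apply/PGL3_eqP; exists k.
have curveB (x : 'cV_3) : x != 0 -> hermitian_form q omega x = 0 ->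
    hermitian_form q omega (B *m x) = 0.
  move=> nzx fx; pose w : nzvec K := exist (fun x => is_true (x != 0)) _ nzx.
  have /(classical_sets.imageP (pact (\pi_(PGL3 K) A)%qT)) :
      hermitian_curve q omega (\pi_(PG2 K) w)%qT by apply/hermitian_curveE.
  by rewrite PGU AB pactE => /hermitian_curveE.
have [|X Y Z nz curveXYZ|u0 v0 uni] := curve_preserving_unitary
    (B 0 0) (B 0 1) (B 1 0) (B 1 1) (B 2%:R 0) (B 2%:R 1).
- by rewrite -det_fix_P0 // -unitfE -unitmxE.
- pose w : 'cV[K]_3 := \col_i nth 0 [:: X; Y; Z] i.
  have w0 : w != 0.
    apply: contraTneq nz => /matrixP Ew; have := Ew 0 0; have := Ew 1 0.
    by rewrite !mxE /= => -> ->; rewrite eqxx.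
  have := curveB w w0; rewrite /hermitian_form ![(B *m _) _ _]mxE !sum_ord3 !B2.
  by rewrite !mxE /= !(mul0r, addr0, mul1r); apply.
exists (B 0 0), (B 0 1), (B 1 0), (B 1 1); split=> //.
rewrite AB -projectivityE; congr projectivity.
apply/matrixP=> i j; rewrite [RHS]mxE.
by case: (ord3E i) => ->; case: (ord3E j) => -> /=; rewrite ?B2.
Qed.

Lemma block_det_Mq a b c d : unitary_block a b c d ->
  block_det (projectivity (linmx a b c d)) = a * d - b * c.
Proof. by case=> D0 _ _ _ _; apply: block_det_linmx. Qed.

Lemma block_detM g h : Mq q omega g -> Mq q omega h ->
  block_det (g * h)%g = block_det g * block_det h.
Proof.
move=> /MqP[a [b [c [d [U ->]]]]] /MqP[a' [b' [c' [d' [U' ->]]]]].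
have [[D0 _ _ _ _] [D0' _ _ _ _]] := (U, U').
rewrite -projectivityM ?linmx_unit // linmxM !block_det_linmx //.
  by ring.
rewrite (_ : _ - _ = (a * d - b * c) * (a' * d' - b' * c')); last by ring.
exact: mulf_neq0.
Qed.

(** The determinant of the relation D M^(q) = M is D^2 D^q = D. *)
Lemma block_det_norm g : Mq q omega g -> block_det g ^+ q.+1 = 1.
Proof.
move=> /MqP[a [b [c [d [U ->]]]]]; rewrite block_det_Mq //.
case: U => D0 Ea Eb Ec Ed; apply: (mulfI D0); rewrite mulr1 exprS.
rewrite frobD frobN !frobM mulrA.
transitivity ((a * d - b * c) * a ^+ q * ((a * d - b * c) * d ^+ q)
  - (a * d - b * c) * b ^+ q * ((a * d - b * c) * c ^+ q)); first by ring.
by rewrite Ea Eb Ec Ed.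
Qed.

(** When D = 1 the unitary relation becomes M^(q) = M, and the solutions of
    x^q = x are the elements of F_q. *)
Lemma SL2q_Mq (Fq : finFieldType) (iota : {rmorphism Fq -> K}) g : #|Fq| = q ->
  SL2q iota g <-> Mq q omega g /\ block_det g = 1.
Proof.
move=> cardFq.
have fixedP x : x ^+ q = x <-> exists y, iota y = x.
  split=> [xq|[y <-]]; last by rewrite -rmorphXn /= -cardFq expf_card.
  have : (map_poly iota ('X^#|Fq| - 'X)).[x] == 0.
    by rewrite rmorphB /= map_polyXn map_polyX !hornerE cardFq xq subrr.
  rewrite finField_genPoly map_prod_XsubC horner_prod => /prodf_eq0[y _].
  by rewrite hornerXsubC subr_eq0 => /eqP ->; exists y.
split=> [[a [b [c [d [D1 ->]]]]]|[/MqP[a [b [c [d [U ->]]]]]]].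
  have iD : iota a * iota d - iota b * iota c = 1.
    by rewrite -!rmorphM -rmorphB D1 rmorph1.
  have U : unitary_block (iota a) (iota b) (iota c) (iota d).
    have fix_iota y : iota y ^+ q = iota y by apply/fixedP; exists y.
    by split; rewrite iD ?oner_eq0 // mul1r fix_iota.
  by rewrite block_det_Mq //; split => //; apply: Mq_unitary.
rewrite block_det_Mq // => D1; case: U => _; rewrite D1 !mul1r.
move=> /fixedP[a' Ea] /fixedP[b' Eb] /fixedP[c' Ec] /fixedP[d' Ed].
exists a', b', c', d'; rewrite Ea Eb Ec Ed; split=> //.
by apply: (fmorph_inj iota); rewrite rmorphB !rmorphM rmorph1 /= Ea Eb Ec Ed.
Qed.

(** * The element alpha *)

Section Alpha.
Variable e : K.
Hypotheses (e_neq0 : e != 0) (e_zeta : e ^+ (q - 1) = zeta).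

Let e_frob : e ^+ q = zeta * e.
Proof. by rewrite -e_zeta -exprSr subn1 prednK // ltnW. Qed.

Let alphaE : alpha_mx q e = linmx 0 e^-1 (- (zeta * e)) (1 + zeta).
Proof. by rewrite /alpha_mx e_zeta e_frob. Qed.

Let det_alpha : 0 * (1 + zeta) - e^-1 * - (zeta * e) = zeta.
Proof. by field. Qed.

Lemma unitary_alpha : unitary_block 0 e^-1 (- (zeta * e)) (1 + zeta).
Proof.
rewrite /unitary_block det_alpha; split=> //.
- by rewrite frob0 mulr0.
- by rewrite exprVn e_frob; field; rewrite e_neq0.
- by rewrite frobN frobM e_frob zeta_frob; field.
- by rewrite frobD expr1n zeta_frob; field.
Qed.

Lemma Mq_alpha : Mq q omega (projectivity (alpha_mx q e)).
Proof. by rewrite alphaE; apply/Mq_unitary/unitary_alpha. Qed.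

Lemma block_det_alpha : block_det (projectivity (alpha_mx q e)) = zeta.
Proof. by rewrite alphaE block_det_Mq //; apply: unitary_alpha. Qed.

(** The block of alpha has trace 1 + zeta and determinant zeta; the columns
    (1, e) and (1, zeta e) of P are eigenvectors for 1 and zeta. *)
Lemma alpha_expg : (projectivity (alpha_mx q e) ^+ q.+1 = 1)%g.
Proof.
pose P := linmx 1 1 e (zeta * e).
have uP : P \in unitmx.
  rewrite linmx_unit (_ : _ - _ = (zeta - 1) * e); last by ring.
  by rewrite mulf_neq0 // subr_eq0.
pose D z : 'M[K]_3 := linmx 1 0 0 z.
have uD z : z != 0 -> D z \in unitmx by rewrite linmx_unit mul1r mul0r subr0.
have uA : alpha_mx q e \in unitmx by apply: alpha_mx_unit.
have AP : alpha_mx q e *m P = P *m D zeta.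
  by rewrite alphaE !linmxM; congr linmx; field.
have -> : projectivity (alpha_mx q e)
    = (projectivity (D zeta) ^ (projectivity P)^-1)%g.
  by rewrite /conjg invgK mulgA -projectivityM ?uD // -AP projectivityM // mulgK.
rewrite -conjXg (_ : (_ ^+ _)%g = projectivity (D (zeta ^+ q.+1))).
  by rewrite (prim_expr_order zeta_prim) /D linmx1 projectivity1 conj1g.
elim: q.+1 => [|n IH]; first by rewrite expg0 expr0 /D linmx1 projectivity1.
rewrite expgS IH -projectivityM ?uD ?expf_neq0 // /D linmxM exprS.
by rewrite !(mul0r, mulr0, mul1r, addr0, add0r).
Qed.

End Alpha.

End HermitianUnitary.

Lemma generator_prim_root (F : finFieldType) (e : {unit F}) :
  generator [set: {unit F}] e -> #|F|.-1.-primitive_root (val e).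
Proof.
move=> /eqP gen_e; have oe : #[e]%g = #|F|.-1.
  by rewrite -card_finField_unit gen_e.
have n_gt0 : (0 < #|F|.-1)%N by rewrite -oe order_gt0.
have en1 : val e ^+ #|F|.-1 = 1 by rewrite -FinRing.val_unitX -oe expg_order.
have [m pr_m m_dvd] := prim_order_exists n_gt0 en1.
suff -> : #|F|.-1 = m by [].
apply/eqP; rewrite eqn_dvd; apply/andP; split=> //.
rewrite -oe order_dvdn; apply/eqP/val_inj.
by rewrite FinRing.val_unitX (prim_expr_order pr_m).
Qed.

Theorem corollary3p2
  (p h q : nat) (p_prime : prime p) (p_odd : odd p) (h_gt0 : (0 < h)%N)
  (q_def : q = (p ^ h)%N)
  (Fq Fq2 : finFieldType) (card_Fq : #|Fq| = q) (card_Fq2 : #|Fq2| = (q ^ 2)%N)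
  (K : closedFieldType)
  (iota : {rmorphism Fq -> K}) (iota2 : {rmorphism Fq2 -> K})
  (K_alg : forall x : K, algebraicOver iota2 x)
  (omega : K) (omega_def : omega ^+ (q - 1) = -1)
  (e : {unit Fq2}) (e_prim : generator [set: {unit Fq2}] e) :
  is_internal_sdprod
    (Mq q omega)
    (SL2q iota)
    (cyclic_subgroup (projectivity (alpha_mx q (iota2 (val e))))).
Proof.
have q_gt1 : (1 < q)%N by rewrite -card_Fq finNzRing_gt1.
have pcharKq : [pchar K].-nat q.
  have pK : p \in [pchar K].
    apply: (rmorph_pchar iota); apply: (@card_finPcharP _ p h) => //.
    by rewrite card_Fq.
  by rewrite q_def (eq_pnat _ (GRing.pcharf_eq pK)) pnatX pnat_id.
have omega_neq0 : omega != 0.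
  apply/eqP=> w0; move: omega_def; rewrite w0 expr0n subn_eq0 leqNgt.
  by rewrite q_gt1 => /eqP; rewrite eq_sym oppr_eq0 oner_eq0.
pose E := iota2 (val e).
have E_prim : (q.+1 * (q - 1)).-primitive_root E.
  rewrite /E fmorph_primitive_root (_ : _ * _ = #|Fq2|.-1)%N.
    exact: generator_prim_root.
  by rewrite card_Fq2 [LHS]mulnC -[q.+1]addn1 -subn_sqr exp1n subn1.
have E_neq0 : E != 0 by rewrite fmorph_eq0 -unitfE; apply: valP.
have zeta_prim : q.+1.-primitive_root (E ^+ (q - 1)).
  rewrite -(mulKn (q - 1) (ltn0Sn q)).
  by apply: dvdn_prim_root; rewrite ?dvdn_mulr.
apply: (is_internal_sdprod_character _ _ _ _ block_det q.+1).
- exact: Mq_subgroup.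
- exact: block_detM zeta_prim.
- exact: block_det_norm zeta_prim.
- move=> g; exact: SL2q_Mq zeta_prim _ _ g card_Fq.
- exact: Mq_alpha zeta_prim _ E_neq0 erefl.
- exact: alpha_expg zeta_prim _ E_neq0 erefl.
- by rewrite (block_det_alpha _ _ _ _ _ zeta_prim).
Qed.
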